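(* A polynomial $u\in\mathbb{Z}[x]$ of degree at least $1$ is locally nilpotent at $1$ if and only if it is of one of the following forms: (1) $(x-1)p(x)$ with $p(x)\in\mathbb{Z}[x]\setminus\{0\}$ (these are nilpotent at $1$ of index $1$); (2) $-2x+4+p(x)(x-1)(x-2)$ with $p(x)\in\mathbb{Z}[x]$ (these are nilpotent at $1$ of index $2$); (3) $-2x^2+7x-3+p(x)(x-1)(x-2)(x-3)$ with $p(x)\in\mathbb{Z}[x]$ (these are nilpotent at $1$ of index $3$); (4) $x+1$ (which is locally nilpotent but not nilpotent at $1$).
   Context: For $u\in\mathbb{Z}[x]$ of degree at least $1$, define iterates $u^{(1)}=u$ and $u^{(n+1)}(x)=u(u^{(n)}(x))$. $u$ is locally nilpotent at $r\in\mathbb{Z}$ if for every prime $p$ there exists $m\ge1$ with $u^{(m)}(r)\equiv 0\pmod p$. $u$ is nilpotent at $r$ if $u^{(n)}(r)=0$ for some $n\ge 1$, and the nilpotency index is the least such $n$. *)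

(* Defs.v *)
From mathcomp Require Import all_boot all_order all_algebra.

Set Implicit Arguments.
Unset Strict Implicit.
Unset Printing Implicit Defensive.

Import Order.TTheory GRing.Theory Num.Theory.

Local Open Scope ring_scope.

(* [piter u n] is the n-th iterate u^(n); the value at n = 0 is 'X, and only
   n >= 1 is used below. *)
Definition piter (u : {poly int}) (n : nat) : {poly int} :=
  iter n (fun q => u \Po q) 'X.

Lemma piter1 (u : {poly int}) : piter u 1 = u.
Proof. exact: comp_polyXr. Qed.

Lemma piterS (u : {poly int}) (n : nat) : piter u n.+1 = u \Po piter u n.
Proof. by []. Qed.

Definition locally_nilpotent (u : {poly int}) (r : int) : Prop :=
  forall p : nat, prime p ->
    exists m : nat, (1 <= m)%N /\ ((piter u m).[r] = 0 %[mod p])%Z.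

Definition nilpotent (u : {poly int}) (r : int) : Prop :=
  exists n : nat, (1 <= n)%N /\ (piter u n).[r] = 0.

Definition nilpotent_of_index (u : {poly int}) (r : int) (n : nat) : Prop :=
  [/\ (1 <= n)%N, (piter u n).[r] = 0
    & forall m : nat, (1 <= m < n)%N -> (piter u m).[r] <> 0].

(* Main.v *)
Require Import Defs.
From mathcomp Require Import all_boot all_order all_algebra.
From mathcomp Require Import zify ring.

Set Implicit Arguments.
Unset Strict Implicit.
Unset Printing Implicit Defensive.

Import GRing.Theory.

Local Open Scope ring_scope.

(** Suppose the orbit of 1 starts 1, 2, ..., n and put c = u(n). If a prime q
    divides c - j for some 1 <= j <= n, then modulo q the orbit stays in
    {1, ..., n}, and since it meets 0 this forces q <= n: every c - j is a
    nonzero n-smooth integer. Moreover u - X - 1 vanishes at 1, ..., n - 1, so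
    (n - 1)! divides c - (n + 1). An n-smooth integer prime to (n - 1)! has no
    prime factor other than n; so it is a unit if n is not prime, and of two
    coprime such integers one is always a unit. Applied to c - n for n = 1 and
    n = 4, to c - 1 and c - 2 for n = 2, to c - 1 and c - 3 for n = 3, and to
    c - n and (c - n + 1)/2 for n >= 5, this leaves only c = n + 1, or c = 0
    with n <= 3. Hence either the orbit reaches 0 in at most three steps or u
    agrees with X + 1 at all positive integers. *)

Lemma roots_prod_XsubC (R : idomainType) (p : {poly R}) (rs : seq R) :
  all (root p) rs -> uniq rs ->
  exists q, p = q * \prod_(z <- rs) ('X - z%:P).
Proof.
elim: rs => [|z rs IHrs] /=; first by exists p; rewrite big_nil mulr1.
case/andP=> pz0 prs0 /andP[z_notin_rs /(IHrs prs0)[q p_eq]].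
have /factor_theorem[q' q_eq] : root q z.
  by move: pz0; rewrite p_eq rootM root_prod_XsubC (negPf z_notin_rs) orbF.
by exists q'; rewrite big_cons mulrA -q_eq.
Qed.

Lemma eq_horner_prod_XsubC (R : idomainType) (u w : {poly R}) (rs : seq R) :
  {in rs, forall z, u.[z] = w.[z]} -> uniq rs ->
  exists q, u = w + q * \prod_(z <- rs) ('X - z%:P).
Proof.
move=> eq_uw /(@roots_prod_XsubC _ (u - w))[|q uw_eq].
  by apply/allP => z /eq_uw uwz; rewrite rootE !hornerE uwz subrr.
by exists q; rewrite -uw_eq addrC subrK.
Qed.

Lemma eqz_mod_horner (u : {poly int}) (d x y : int) :
  (x = y %[mod d])%Z -> (u.[x] = u.[y] %[mod d])%Z.
Proof.
move/eqP; rewrite eqz_mod_dvd => d_dvd_xy; apply/eqP; rewrite eqz_mod_dvd.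
have /factor_theorem[q uy_eq] : root (u - u.[y]%:P) y.
  by rewrite rootE !hornerE subrr.
have -> : u.[x] - u.[y] = (u - u.[y]%:P).[x] by rewrite !hornerE.
by rewrite uy_eq hornerM hornerXsubC dvdz_mull.
Qed.

Lemma piterS_horner (u : {poly int}) (m : nat) (r : int) :
  (piter u m.+1).[r] = u.[(piter u m).[r]].
Proof. by rewrite piterS horner_comp. Qed.

Lemma piter_mod_preperiodic (u : {poly int}) (r d : int) (j n : nat) :
  (j < n)%N -> ((piter u n).[r] = (piter u j).[r] %[mod d])%Z ->
  forall m, exists2 i, (i < n)%N &
    ((piter u m).[r] = (piter u i).[r] %[mod d])%Z.
Proof.
move=> lt_jn return_eq; elim=> [|m [i lt_in /(eqz_mod_horner u)]].
  by exists 0%N; first lia.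
rewrite -!piterS_horner => step_eq.
have [lt_iSn|le_niS] := ltnP i.+1 n; first by exists i.+1.
by exists j; rewrite // step_eq (_ : i.+1 = n) //; lia.
Qed.

Lemma locally_nilpotent_prime_dvdz (u : {poly int}) (r : int) (q j n : nat) :
  locally_nilpotent u r -> prime q -> (j < n)%N ->
  (q %| (piter u n).[r] - (piter u j).[r])%Z ->
  exists2 i, (i < n)%N & (q %| (piter u i).[r])%Z.
Proof.
move=> loc_u q_prime lt_jn; rewrite -eqz_mod_dvd => /eqP return_eq.
have [m [_ um0]] := loc_u q q_prime.
have [i lt_in um_eq] := piter_mod_preperiodic lt_jn return_eq m.
by exists i => //; apply/dvdz_mod0P; rewrite -um_eq um0 mod0z.
Qed.

Lemma nilpotent_of_index_locally_nilpotent (u : {poly int}) (r : int)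
    (n : nat) :
  nilpotent_of_index u r n -> locally_nilpotent u r.
Proof. by case=> n_gt0 un0 _ p _; exists n; rewrite un0. Qed.

Definition successor_below (u : {poly int}) (n : nat) : Prop :=
  forall i : nat, (0 < i < n)%N -> u.[i%:Z] = i.+1%:Z.

Lemma successor_below1 (u : {poly int}) : successor_below u 1.
Proof. by case=> [|[]]. Qed.

Lemma successor_belowS (u : {poly int}) (n : nat) :
  successor_below u n -> u.[n%:Z] = n.+1%:Z -> successor_below u n.+1.
Proof.
move=> succ_u un i i_bounds; have [->//|neq_in] := eqVneq i n.
by apply: succ_u; lia.
Qed.

Lemma successor_below_XD1 (n : nat) : successor_below ('X + 1) n.
Proof. by move=> i _; rewrite !hornerE; lia. Qed.

Lemma piter_successor_below (u : {poly int}) (n m : nat) :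
  successor_below u n -> (m < n)%N -> (piter u m).[1] = m.+1%:Z.
Proof.
move=> succ_u; elim: m => [_|m IHm lt_mn]; first by rewrite hornerX.
by rewrite piterS_horner IHm ?succ_u //; lia.
Qed.

Lemma successor_below_nilpotent_of_index (u : {poly int}) (n : nat) :
  successor_below u n.+1 -> u.[n.+1%:Z] = 0 -> nilpotent_of_index u 1 n.+1.
Proof.
move=> succ_u un0; split=> [//||m /andP[_ lt_mn]].
  by rewrite piterS_horner (piter_successor_below succ_u).
by rewrite (piter_successor_below succ_u).
Qed.

Lemma successor_below_root (u : {poly int}) (n : nat) :
  successor_below u n.+1 ->
  all (root (u - ('X + 1))) [seq i.+1%:Z | i <- iota 0 n].
Proof.
move=> succ_u; apply/allP => _ /mapP[i i_in ->].
rewrite mem_iota in i_in.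
by rewrite rootE !hornerE succ_u; [apply/eqP | ]; lia.
Qed.

Lemma uniq_map_succz (n : nat) : uniq [seq i.+1%:Z | i <- iota 0 n].
Proof. by rewrite map_inj_uniq ?iota_uniq // => i j []. Qed.

Lemma successor_below_eq_XD1 (u : {poly int}) :
  successor_below u (size (u - ('X + 1))).+1 -> u = 'X + 1.
Proof.
move/successor_below_root => roots; apply/eqP; rewrite -subr_eq0; apply/eqP.
apply: roots_geq_poly_eq0 roots (uniq_map_succz _) _.
by rewrite size_map size_iota.
Qed.

Lemma prod_subz_fact (n : nat) :
  \prod_(0 <= i < n) (n.+1%:Z - i.+1%:Z) = n`!%:Z.
Proof.
rewrite fact_prod big_add1 (big_morph Posz PoszM (erefl _)) big_nat_rev.
by apply: eq_big_nat => i i_bounds; lia.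
Qed.

Lemma fact_dvdz_successor_below (u : {poly int}) (n : nat) :
  successor_below u n.+1 -> (n`!%:Z %| u.[n.+1%:Z] - n.+2%:Z)%Z.
Proof.
move/successor_below_root/roots_prod_XsubC/(_ (uniq_map_succz n)) => [q u_eq].
have -> : u.[n.+1%:Z] - n.+2%:Z = (u - ('X + 1)).[n.+1%:Z].
  by rewrite !hornerE; lia.
rewrite u_eq hornerM horner_prod big_map -prod_subz_fact.
under eq_bigr do rewrite hornerXsubC.
by rewrite /index_iota subn0 dvdz_mull.
Qed.

Lemma pnat_coprime_eq1 (p a b : nat) :
  p.-nat a -> p.-nat b -> coprime a b -> a = 1%N \/ b = 1%N.
Proof.
move=> /p_natP[[|k] ->] /p_natP[[|l] ->]; [by left | by left | by right | ].
rewrite coprime_pexpl // coprime_pexpr // /coprime gcdnn => /eqP->.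
by left; rewrite exp1n.
Qed.

(* [pnat] only holds of positive integers, so 0 is not smooth. *)
Definition smooth (n : nat) (z : int) : bool := [pred p | p <= n]%N.-nat `|z|%N.

Lemma smoothP (n : nat) (z : int) :
  reflect (forall q, prime q -> (q %| z)%Z -> (q <= n)%N) (smooth n z).
Proof.
have [->|z_neq0] := eqVneq z 0; last first.
  apply: (iffP (pnatP _ _)) => [|primes_le q q_prime|primes_le q q_prime].
  - by rewrite absz_gt0.
  - by rewrite dvdzE; apply: primes_le.
  - by move=> q_dvd_z; apply: primes_le; rewrite ?dvdzE.
apply: (iffP idP) => [//|primes_le]; have [q lt_nq q_prime] := prime_above n.
by have := primes_le q q_prime (dvdz0 _); rewrite leqNgt lt_nq.
Qed.

Lemma smooth_coprime_fact_pnat (n : nat) (z : int) :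
  smooth n.+1 z -> coprimez z n`! -> n.+1.-nat `|z|%N.
Proof.
move=> smooth_z coprime_z; apply: sub_in_pnat smooth_z => p.
rewrite mem_primes => /and3P[p_prime z_gt0 p_dvd_z] /=.
rewrite !inE leq_eqVlt => /orP[//|lt_pn].
have := coprime_dvdl p_dvd_z coprime_z.
by rewrite prime_coprime // dvdn_fact // prime_gt0.
Qed.

Lemma smooth_nonprime_unit (n : nat) (z : int) :
  smooth n.+1 z -> coprimez z n`! -> ~~ prime n.+1 -> `|z|%N = 1%N.
Proof.
move=> smooth_z coprime_z /negPf n_nonprime.
have := part_pnat_id (smooth_coprime_fact_pnat smooth_z coprime_z).
by rewrite p_part lognE n_nonprime.
Qed.

Lemma smooth_coprime_unit (n : nat) (y z : int) :
  smooth n.+1 y -> smooth n.+1 z -> coprimez y n`! -> coprimez z n`! ->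
  coprimez y z -> `|y|%N = 1%N \/ `|z|%N = 1%N.
Proof.
move=> smooth_y smooth_z coprime_y coprime_z coprime_yz.
by apply: (@pnat_coprime_eq1 n.+1) coprime_yz; exact: smooth_coprime_fact_pnat.
Qed.

Definition smooth_gaps (n : nat) (c : int) : Prop :=
  forall j : nat, (0 < j <= n)%N -> smooth n (c - j%:Z).

Lemma locally_nilpotent_smooth_gaps (u : {poly int}) (n : nat) :
  locally_nilpotent u 1 -> successor_below u n.+1 ->
  smooth_gaps n.+1 u.[n.+1%:Z].
Proof.
move=> loc_u succ_u [//|j] lt_jn; apply/smoothP => q q_prime.
have piter_succ := piter_successor_below succ_u.
rewrite -(piter_succ j) // -(piter_succ n) // -piterS_horner.
case/(locally_nilpotent_prime_dvdz loc_u q_prime lt_jn) => i lt_in.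
by rewrite piter_succ // dvdzE => /dvdn_leq/leq_trans; apply.
Qed.

Lemma smooth_gaps_neq (n : nat) (c : int) (j : nat) :
  smooth_gaps n c -> (0 < j <= n)%N -> c <> j%:Z.
Proof.
by move=> gaps /gaps smooth_cj c_eq; move: smooth_cj; rewrite c_eq subrr.
Qed.

Lemma smooth_gaps1 (c : int) : smooth_gaps 1 c -> c = 0 \/ c = 2.
Proof.
move=> gaps.
have := smooth_nonprime_unit (gaps 1 isT) (coprimen1 _) isT.
by lia.
Qed.

Lemma smooth_gaps2 (c : int) : smooth_gaps 2 c -> c = 0 \/ c = 3.
Proof.
move=> gaps; have neq1 := smooth_gaps_neq gaps (j := 1) isT.
have neq2 := smooth_gaps_neq gaps (j := 2) isT.
have coprime12 : coprimez (c - 1) (c - 2).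
  by apply/coprimezP; exists (1, -1) => /=; ring.
have := smooth_coprime_unit (gaps 1 isT) (gaps 2 isT)
  (coprimen1 _) (coprimen1 _) coprime12.
by lia.
Qed.

Lemma smooth_gaps3 (c : int) :
  smooth_gaps 3 c -> (2 %| c - 4)%Z -> c = 0 \/ c = 4.
Proof.
move=> gaps /dvdzP[k c_eq]; have {}c_eq : c = 4 + 2 * k by lia.
have neq2 := smooth_gaps_neq gaps (j := 2) isT.
have coprime1 : coprimez (c - 1) 2.
  by apply/coprimezP; exists (-1, k + 2) => /=; lia.
have coprime3 : coprimez (c - 3) 2.
  by apply/coprimezP; exists (1, - k) => /=; lia.
have coprime13 : coprimez (c - 1) (c - 3).
  by apply/coprimezP; exists (- k, k + 1) => /=; rewrite c_eq; ring.
have := smooth_coprime_unit (gaps 1 isT) (gaps 3 isT)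
  coprime1 coprime3 coprime13.
by lia.
Qed.

Lemma smooth_gaps4 (c : int) :
  smooth_gaps 4 c -> (6 %| c - 5)%Z -> c = 5.
Proof.
move=> gaps /dvdzP[k c_eq].
have coprime4 : coprimez (c - 4) 6.
  by apply/coprimezP; exists (1, - k) => /=; lia.
by have := smooth_nonprime_unit (gaps 4 isT) coprime4 isT; lia.
Qed.

Lemma smooth_gaps_ge5 (n : nat) (c : int) : (4 <= n)%N ->
  smooth_gaps n.+1 c -> (n`!%:Z %| c - n.+2%:Z)%Z -> c = n.+2%:Z.
Proof.
move=> n_ge4 gaps fact_dvd.
have /dvdzP[k c_eq] : (24 %| c - n.+2%:Z)%Z.
  apply: dvdz_trans fact_dvd; rewrite dvdzE.
  by rewrite -(@bin_fact n 4) // dvdn_mull // dvdn_mulr.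
have smooth_n : smooth n.+1 (1 + 24 * k).
  by rewrite (_ : 1 + 24 * k = c - n.+1%:Z); [apply: gaps | ]; lia.
have smooth_half : smooth n.+1 (1 + 12 * k).
  apply: (@pnat_dvd _ `|c - n%:Z|); last by apply: gaps; lia.
  by rewrite (_ : c - n%:Z = 2 * (1 + 12 * k)) ?abszM ?dvdn_mull //; lia.
have coprime_fact z : coprimez z (c - n.+2%:Z) -> coprimez z n`!.
  by apply: coprimez_dvdr.
have coprime_n : coprimez (1 + 24 * k) n`!.
  by apply/coprime_fact/coprimezP; exists (1, -1) => /=; lia.
have coprime_half : coprimez (1 + 12 * k) n`!.
  apply/coprime_fact/coprimezP; exists (1 - 12 * k, 6 * k) => /=.
  by rewrite c_eq; ring.
have coprime_n_half : coprimez (1 + 24 * k) (1 + 12 * k).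
  by apply/coprimezP; exists (-1, 2) => /=; ring.
have := smooth_coprime_unit smooth_n smooth_half
  coprime_n coprime_half coprime_n_half.
by lia.
Qed.

Lemma smooth_gaps_fact_dvd (n : nat) (c : int) :
  smooth_gaps n.+1 c -> (n`!%:Z %| c - n.+2%:Z)%Z ->
  c = n.+2%:Z \/ c = 0 /\ (n < 3)%N.
Proof.
case: n => [|[|[|[|n]]]] gaps fact_dvd.
- by case: (smooth_gaps1 gaps); [right | left].
- by case: (smooth_gaps2 gaps); [right | left].
- by case: (smooth_gaps3 gaps fact_dvd); [right | left].
- by left; apply: smooth_gaps4.
- by left; apply: smooth_gaps_ge5 gaps fact_dvd.
Qed.

Lemma locally_nilpotent_orbit_cases (u : {poly int}) (n : nat) :
  locally_nilpotent u 1 ->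
  successor_below u n.+1 \/
  exists2 m, (m < 3)%N & successor_below u m.+1 /\ u.[m.+1%:Z] = 0.
Proof.
move=> loc_u; elim: n => [|n [succ_u|]]; last by right.
  by left; exact: successor_below1.
have gaps := locally_nilpotent_smooth_gaps loc_u succ_u.
have fact_dvd := fact_dvdz_successor_below succ_u.
have [un|[un0 n_lt3]] := smooth_gaps_fact_dvd gaps fact_dvd.
  by left; exact: successor_belowS.
by right; exists n.
Qed.

Lemma orbit_1_0_form (u : {poly int}) :
  u <> 0 -> u.[1] = 0 -> exists p, p <> 0 /\ u = ('X - 1) * p.
Proof.
move=> u_neq0 /eqP/factor_theorem[p u_eq]; exists p; split.
  by move=> p0; apply: u_neq0; rewrite u_eq p0 mul0r.
by rewrite u_eq polyC1 mulrC.
Qed.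

Lemma orbit_1_2_0_form (u : {poly int}) :
  successor_below u 2 -> u.[2] = 0 ->
  exists p, u = - 2 * 'X + 4 + p * ('X - 1) * ('X - 2).
Proof.
move=> succ_u u2.
have [z|//|p ->] := @eq_horner_prod_XsubC _ u (- 2 * 'X + 4) [:: 1; 2].
  by rewrite !inE => /orP[]/eqP->; rewrite !hornerE ?u2 ?(succ_u 1).
by exists p; rewrite !big_cons big_nil mulr1 mulrA polyC1 polyC_natr.
Qed.

Lemma orbit_1_2_3_0_form (u : {poly int}) :
  successor_below u 3 -> u.[3] = 0 ->
  exists p, u = - 2 * 'X^2 + 7 * 'X - 3 + p * ('X - 1) * ('X - 2) * ('X - 3).
Proof.
move=> succ_u u3.
have [z|//|p ->] :=
    @eq_horner_prod_XsubC _ u (- 2 * 'X^2 + 7 * 'X - 3) [:: 1; 2; 3].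
  rewrite !inE => /or3P[]/eqP->;
    by rewrite !hornerE ?u3 ?(succ_u 1) ?(succ_u 2).
by exists p; rewrite !big_cons big_nil mulr1 !mulrA polyC1 !polyC_natr.
Qed.

Lemma locally_nilpotent_forms (u : {poly int}) :
  u <> 0 -> locally_nilpotent u 1 ->
  [\/ exists p : {poly int}, p <> 0 /\ u = ('X - 1) * p,
      exists p : {poly int}, u = - 2 * 'X + 4 + p * ('X - 1) * ('X - 2),
      exists p : {poly int},
        u = - 2 * 'X^2 + 7 * 'X - 3 + p * ('X - 1) * ('X - 2) * ('X - 3)
    | u = 'X + 1].
Proof.
move=> u_neq0 loc_u; pose d := size (u - ('X + 1)).
have [succ_u|] := locally_nilpotent_orbit_cases d loc_u.
  by constructor 4; exact: successor_below_eq_XD1.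
case=> [[|[|[|//]]]] _ [succ_u un0].
- by constructor 1; exact: orbit_1_0_form.
- by constructor 2; exact: orbit_1_2_0_form.
- by constructor 3; exact: orbit_1_2_3_0_form.
Qed.

Lemma orbit_1_0_index (p : {poly int}) :
  nilpotent_of_index (('X - 1) * p) 1 1.
Proof.
apply: successor_below_nilpotent_of_index; first exact: successor_below1.
by rewrite !hornerE.
Qed.

Lemma orbit_1_2_0_index (p : {poly int}) :
  nilpotent_of_index (- 2 * 'X + 4 + p * ('X - 1) * ('X - 2)) 1 2.
Proof.
apply: successor_below_nilpotent_of_index; last by rewrite !hornerE /=; lia.
by case=> [|[|]] // _; rewrite !hornerE /=; lia.
Qed.

Lemma orbit_1_2_3_0_index (p : {poly int}) :
  nilpotent_of_index
    (- 2 * 'X^2 + 7 * 'X - 3 + p * ('X - 1) * ('X - 2) * ('X - 3)) 1 3.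
Proof.
apply: successor_below_nilpotent_of_index; last by rewrite !hornerE /=; lia.
by case=> [|[|[|]]] // _; rewrite !hornerE /=; lia.
Qed.

Lemma piter_XD1 (m : nat) : (piter ('X + 1) m).[1] = m.+1%:Z.
Proof. exact: piter_successor_below (@successor_below_XD1 m.+1) (ltnSn m). Qed.

Lemma locally_nilpotent_XD1 : locally_nilpotent ('X + 1) 1.
Proof.
move=> p p_prime; have p_gt1 := prime_gt1 p_prime.
exists p.-1; split; first by lia.
by rewrite piter_XD1 prednK ?modzz ?mod0z // ltnW.
Qed.

Lemma not_nilpotent_XD1 : ~ nilpotent ('X + 1) 1.
Proof. by case=> n [_]; rewrite piter_XD1. Qed.

Theorem theorem1 :
  [/\ forall u : {poly int}, (1 < size u)%N ->
        (locally_nilpotent u 1 <->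
         [\/ exists p : {poly int}, p <> 0 /\ u = ('X - 1) * p,
             exists p : {poly int},
               u = - 2 * 'X + 4 + p * ('X - 1) * ('X - 2),
             exists p : {poly int},
               u = - 2 * 'X^2 + 7 * 'X - 3
                   + p * ('X - 1) * ('X - 2) * ('X - 3)
           | u = 'X + 1]),
      forall p : {poly int}, p <> 0 ->
        nilpotent_of_index (('X - 1) * p) 1 1,
      forall p : {poly int},
        nilpotent_of_index (- 2 * 'X + 4 + p * ('X - 1) * ('X - 2)) 1 2,
      forall p : {poly int},
        nilpotent_of_index
          (- 2 * 'X^2 + 7 * 'X - 3 + p * ('X - 1) * ('X - 2) * ('X - 3)) 1 3
    & locally_nilpotent ('X + 1) 1 /\ ~ nilpotent ('X + 1) 1].
Proof.
split=> [u size_u|p _|p|p|].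
- split.
    apply: locally_nilpotent_forms => u0.
    by move: size_u; rewrite u0 size_poly0.
  case=> [[p [_ ->]]|[p ->]|[p ->]|->].
  + exact/nilpotent_of_index_locally_nilpotent/orbit_1_0_index.
  + exact/nilpotent_of_index_locally_nilpotent/orbit_1_2_0_index.
  + exact/nilpotent_of_index_locally_nilpotent/orbit_1_2_3_0_index.
  + exact: locally_nilpotent_XD1.
- exact: orbit_1_0_index.
- exact: orbit_1_2_0_index.
- exact: orbit_1_2_3_0_index.
- by split; [exact: locally_nilpotent_XD1 | exact: not_nilpotent_XD1].
Qed.
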